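(* The regret upper bound $\mathcal O\left(NM\hat p\left(\frac1\lambda\sqrt{UT\log T}+\varepsilon\sqrt T\right)\right)$ of the UCB-Add-On algorithm for the online add-on discount revenue management problem is tight up to the logarithmic term. More specifically, the regret is lower-bounded by $$\Omega\left(NM\hat p\sqrt{UT}\right):$$ there is a problem instance on which this part of the regret is inevitable for any learning algorithm. Such an instance is obtained by taking the add-on space limit $S=0$, primary demand $\alpha_{N+m}(p)=0$ and add-on purchase probability $\beta_{N+m}(p)=1$ for all supportive products $m=1,\dots,M$ and all $p\in\Omega_s$, with (for simplicity) $\hat p$ the only price available for the supportive products.
   Context: **Problem.** There are $N$ core products and $M$ supportive products, finite sets $\Omega_c,\Omega_s,\Omega_a$ of nonnegative prices (for core products, supportive products and add-on discounts), an integer space limit $S\ge 0$, and demand functions $\alpha_n:\Omega_c\to[0,1]$ ($n=1,\dots,N$), $\alpha_{N+m}:\Omega_s\to[0,1]$, $\beta_{N+m}:\Omega_s\to[0,1]$, $\beta'_{N+m}:\Omega_a\to[0,1]$ ($m=1,\dots,M$). A feasible policy $\Pi$ specifies $p_n\in\Omega_c$ for $n=1,\dots,N$ and $p_{N+m}\in\Omega_s$, $p'_{N+m}\in\Omega_a$, $I_{N+m}\in\{0,1\}$ for $m=1,\dots,M$, with $\sum_{m=1}^M I_{N+m}\le S$ and $p'_{N+m}<p_{N+m}$ for all $m=1,\dots,M$. Its one-period expected revenue is $$\mathcal R(\Pi)=\sum_{n=1}^N\alpha_n(p_n)p_n+\sum_{m=1}^M\alpha_{N+m}(p_{N+m})p_{N+m}+\Big[\sum_{n=1}^N\alpha_n(p_n)\Big]\sum_{m=1}^M\Big[I_{N+m}\beta'_{N+m}(p'_{N+m})p'_{N+m}+(1-I_{N+m})\beta_{N+m}(p_{N+m})p_{N+m}\Big].$$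 $\mathcal R^*$ is the maximum of $\mathcal R(\Pi)$ over feasible policies; $\hat p:=\max_{p\in\Omega_c\cup\Omega_s}p$; $U:=\max\{|\Omega_c|,|\Omega_s|,|\Omega_a|\}$. **Demand.** In each period $t=1,\dots,T$ under policy $\Pi$, the primary demand for core product $n$ is Bernoulli with mean $\alpha_n(p_n)$ and the primary demand for supportive product $m$ is Bernoulli with mean $\alpha_{N+m}(p_{N+m})$. A customer who has purchased one core product continues to purchase supportive product $m$ (add-on purchase) with probability $\beta'_{N+m}(p'_{N+m})$ if $I_{N+m}=1$ and $\beta_{N+m}(p_{N+m})$ if $I_{N+m}=0$. Demand is independent across products. Purchases are observed; the demand functions are unknown. $\lambda$ is the lowest possible probability that the total primary demand is non-zero. **Learning algorithm and regret.** A learning algorithm chooses the policy $\Pi_t$ in each period from past observations, without knowledge of the demand functions. $\mathrm{Regret}(T)=\mathbf E\big[\sum_{t=1}^T(\mathcal R^*-\mathcal R(\Pi_t))\big]$. **Discretized DP Algorithm** (input: the price sets, all values of the demand functions, and a positive integer $K$). Part 1. For each $m$ and each $\gamma\in\{0,\frac1K,\dots,\frac{NK}{K}\}$, compute $r_{N+m}(\gamma)=\max_{p\in\Omega_s}\{\alpha_{N+m}(p)p+\gamma\beta_{N+m}(p)p\}$ and $r'_{N+m}(\gamma)=\max_{p\in\Omega_s,\,p'\in\Omega_a,\,p'<p}\{\alpha_{N+m}(p)p+\gamma\beta'_{N+m}(p')p'\}$. For each $\gamma$, sort $r'_{N+m}(\gamma)-r_{N+m}(\gamma)$ in descending order; set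 $I_{N+m}(\gamma)=1$ if this difference is positive and among the first $S$ entries, else $I_{N+m}(\gamma)=0$. Set $\mathcal R_s(\gamma)=\sum_m\big[r_{N+m}(\gamma)+I_{N+m}(\gamma)(r'_{N+m}(\gamma)-r_{N+m}(\gamma))\big]$. Part 2. Let $\hat\alpha_n(p)$ be $\alpha_n(p)$ rounded to the nearest integer multiple of $1/K$. Solve by backward induction $V_{N+1}(\gamma)=\mathcal R_s(\gamma)$, $V_n(\gamma)=\max_{p_n\in\Omega_c}[\alpha_n(p_n)p_n+V_{n+1}(\gamma+\hat\alpha_n(p_n))]$. Output the optimal decisions retrieved along the optimality equations starting from $V_1(0)$, together with the supportive decisions attaining $\mathcal R_s$ at the terminal $\gamma$. **UCB-Add-On algorithm** (parameter $\varepsilon$). It maintains, initialized at $0$: counters $c_n(p)$ and $c_{N+m}(p)$, the numbers of periods in which price $p$ has been used for core product $n$ (resp. supportive product $m$); $c^{(a,1)}_{N+m}(p')$, the number of core products purchased when supportive product $m$ is selected for add-on discount at discount price $p'$; $c^{(a,2)}_{N+m}(p)$, the number of core products purchased when supportive product $m$ is not selected for add-on discount and is offered at original price $p$; and the corresponding empirical averages of the demand parameters. Time is divided into episodes. At the first period $t$ of episode $\tau$, for every parameter it forms $\min\big(1,\ \text{empirical average}+\sqrt{2\log t/\text{counter}}\big)$ (equal to $1$ when the counter is $0$), and runs the Discretized DP Algorithm with these values as demand functions and $K=\lceil\sqrt t/\varepsilon\rceil$, obtaining policy $\Pi_\tau$. It keeps using $\Pi_\tau$, updating the averages and counters in each period,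 and terminates the episode when the value of at least one of the counters associated with the selected add-on products and prices under $\Pi_\tau$ is doubled within the episode. *)

(* Defs.v *)
From HB Require Import structures.
From mathcomp Require Import all_boot all_order all_algebra finmap.
From mathcomp Require Import all_classical all_reals all_analysis.

Set Implicit Arguments.
Unset Strict Implicit.
Unset Printing Implicit Defensive.

Import Order.TTheory GRing.Theory Num.Theory.

Local Open Scope fset_scope.
Local Open Scope ring_scope.

(* What is known to the seller: the price sets and the space limit.           *)
Record market (R : realType) (N M : nat) := Market {
  core_prices : {fset R};
  supp_prices : {fset R};
  disc_prices : {fset R};
  space_limit : nat;
  core_prices_ge0 : forall p, p \in core_prices -> 0 <= p;
  supp_prices_ge0 : forall p, p \in supp_prices -> 0 <= p;
  disc_prices_ge0 : forall p, p \in disc_prices -> 0 <= p }.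

(* What is unknown to the seller: the demand functions.                       *)
Record demand (R : realType) (N M : nat) (mk : market R N M) := Demand {
  alpha_core : 'I_N -> core_prices mk -> R;
  alpha_supp : 'I_M -> supp_prices mk -> R;
  beta_orig : 'I_M -> supp_prices mk -> R;
  beta_disc : 'I_M -> disc_prices mk -> R;
  alpha_core_prob : forall n p, 0 <= alpha_core n p <= 1;
  alpha_supp_prob : forall m p, 0 <= alpha_supp m p <= 1;
  beta_orig_prob : forall m p, 0 <= beta_orig m p <= 1;
  beta_disc_prob : forall m p, 0 <= beta_disc m p <= 1 }.

Section AddOnDiscount.
Variables (R : realType) (N M : nat).
Implicit Types mk : market R N M.

(* Prices are nonnegative, so the neutral element 0 does not interfere.       *)
Definition max_price mk : R :=
  \big[Num.max/0]_(p <- core_prices mk `|` supp_prices mk) p.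

Definition max_num_prices mk : nat :=
  maxn #|` core_prices mk| (maxn #|` supp_prices mk| #|` disc_prices mk|).

(* (core prices, supportive prices, discount prices, products m with I_m = 1) *)
Definition policy mk : finType :=
  ({ffun 'I_N -> core_prices mk} * {ffun 'I_M -> supp_prices mk} *
   {ffun 'I_M -> disc_prices mk} * {set 'I_M})%type.

Definition core_price mk (pi : policy mk) (n : 'I_N) := pi.1.1.1 n.
Definition supp_price mk (pi : policy mk) (m : 'I_M) := pi.1.1.2 m.
Definition disc_price mk (pi : policy mk) (m : 'I_M) := pi.1.2 m.
Definition selected mk (pi : policy mk) : {set 'I_M} := pi.2.

Definition feasible mk (pi : policy mk) : bool :=
  (#|selected pi| <= space_limit mk)%N &&
  [forall m, fsval (disc_price pi m) < fsval (supp_price pi m)].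

Section Demand.
Variables (mk : market R N M) (d : demand mk).

Definition revenue (pi : policy mk) : R :=
  \sum_(n < N) alpha_core d n (core_price pi n) * fsval (core_price pi n)
  + \sum_(m < M) alpha_supp d m (supp_price pi m) * fsval (supp_price pi m)
  + (\sum_(n < N) alpha_core d n (core_price pi n)) *
    \sum_(m < M)
      if m \in selected pi
      then beta_disc d m (disc_price pi m) * fsval (disc_price pi m)
      else beta_orig d m (supp_price pi m) * fsval (supp_price pi m).

(* Revenues are nonnegative, so this is the maximum as soon as some policy is *)
(* feasible.                                                                  *)
Definition opt_revenue : R :=
  \big[Num.max/0]_(pi : policy mk | feasible pi) revenue pi.

Definition addon_prob (pi : policy mk) (m : 'I_M) : R :=
  if m \in selected pi then beta_disc d m (disc_price pi m)
  else beta_orig d m (supp_price pi m).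

End Demand.

(* What is observed in one period: primary purchases of each core and of each *)
(* supportive product, and whether the buyer of core product n makes the      *)
(* add-on purchase of supportive product m.                                   *)
Definition observation : finType :=
  ({ffun 'I_N -> bool} * {ffun 'I_M -> bool} *
   {ffun 'I_N * 'I_M -> bool})%type.

Definition core_bought (o : observation) (n : 'I_N) : bool := o.1.1 n.
Definition supp_bought (o : observation) (m : 'I_M) : bool := o.1.2 m.
Definition addon_bought (o : observation) (n : 'I_N) (m : 'I_M) : bool :=
  o.2 (n, m).

(* Law of the observation under a policy. Add-on purchases require a core     *)
(* purchase: they have success probability 0 when core product n is not sold. *)
Definition obs_prob mk (d : demand mk) (pi : policy mk) (o : observation) : R :=
  (\prod_(n < N)
     bernoulli_pmf (alpha_core d n (core_price pi n)) (core_bought o n)) *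
  (\prod_(m < M)
     bernoulli_pmf (alpha_supp d m (supp_price pi m)) (supp_bought o m)) *
  (\prod_(n < N) \prod_(m < M)
     bernoulli_pmf (if core_bought o n then addon_prob d pi m else 0)
                   (addon_bought o n m)).

(* lambda: the lowest probability, over feasible policies, that the total     *)
(* primary demand is nonzero.                                                 *)
Definition primary_nonzero (o : observation) : bool :=
  [exists n, core_bought o n] || [exists m, supp_bought o m].

Definition min_primary_prob mk (d : demand mk) : R :=
  \big[Num.min/1]_(pi : policy mk | feasible pi)
    \sum_(o : observation | primary_nonzero o) obs_prob d pi o.

(* A (possibly randomized) learning algorithm on a known market: it maps the  *)
(* past, listed in chronological order, to a distribution on feasible         *)
(* policies. Since its type mentions no [demand mk], it does not know the     *)
(* demand functions.                                                          *)
Record learning_algorithm mk := LearningAlgorithm {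
  choice_prob : seq (policy mk * observation) -> policy mk -> R;
  choice_prob_ge0 : forall h pi, 0 <= choice_prob h pi;
  choice_prob_sum1 : forall h, \sum_pi choice_prob h pi = 1;
  choice_prob_feasible : forall h pi, ~~ feasible pi -> choice_prob h pi = 0 }.

Definition run_prob mk (d : demand mk) (A : learning_algorithm mk) (T : nat)
    (w : T.-tuple (policy mk * observation)) : R :=
  \prod_(t < T) (choice_prob A (take t w) (tnth w t).1 *
                 obs_prob d (tnth w t).1 (tnth w t).2).

Definition regret mk (d : demand mk) (A : learning_algorithm mk) (T : nat) : R :=
  \sum_(w : T.-tuple (policy mk * observation))
    run_prob d A w *
    \sum_(t < T) (opt_revenue d - revenue d (tnth w t).1).

(* The expression inside O(.) in the regret upper bound of UCB-Add-On.        *)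
Definition ucb_rate mk (d : demand mk) (eps : R) (T : nat) : R :=
  N%:R * M%:R * max_price mk *
  ((min_primary_prob d)^-1 * Num.sqrt ((max_num_prices mk)%:R * T%:R * ln T%:R)
   + eps * Num.sqrt T%:R).

End AddOnDiscount.

(* Main.v *)
Require Import Defs.
From mathcomp Require Import all_boot all_order all_algebra finmap.
From mathcomp Require Import all_classical all_reals all_analysis.
From mathcomp Require Import ring lra.

(** Without add-on space, selling core product [n] at price [p] is worth
    [p + M * phat], so the problem is [N] independent bandits whose arms are the
    [U] core prices. On the hard instances [alpha_n (p)] is inversely
    proportional to [p + M * phat], so that all arms of a product earn the same,
    except a good one which earns [M * phat * gap] more. Turning one arm of
    product [n] into the good one changes the law of the observations only when
    this arm is offered, hence by a relative entropy of at most [6 * gap ^ 2] per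
    offer. By Pinsker's inequality, if [gap] is a small multiple of
    [sqrt (U / T)], the good arm is offered in at most a fixed fraction [< 1] of
    the periods on average over its position; averaging over the positions of
    the good arms of all products makes the losses of the [N] bandits add up. *)

Set Implicit Arguments.
Unset Strict Implicit.
Unset Printing Implicit Defensive.

Import Order.TTheory GRing.Theory Num.Theory.

Local Open Scope fset_scope.
Local Open Scope ring_scope.

(** * Random histories driven by a history-dependent kernel *)

Section Paths.
Variables (R : realType) (X : finType).
Implicit Types (k : seq X -> X -> R) (f : seq X -> R) (g : X -> R).

Definition stochastic k :=
  (forall h x, 0 <= k h x) /\ (forall h, \sum_x k h x = 1).

Definition path_prob k {T} (w : T.-tuple X) : R :=
  \prod_(t < T) k (take t w) (tnth w t).

Definition path_mean k T f : R :=
  \sum_(w : T.-tuple X) path_prob k w * f w.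

Lemma sum_tuple_rcons T (F : T.+1.-tuple X -> R) :
  \sum_(w : T.+1.-tuple X) F w =
  \sum_(w : T.-tuple X) \sum_x F [tuple of rcons w x].
Proof.
rewrite pair_big /=.
pose j (u : T.-tuple X * X) : T.+1.-tuple X := [tuple of rcons u.1 u.2].
have j_inj : injective j.
  move=> [u x] [v y] /(congr1 val) /= /rcons_inj [uv ->].
  by congr (_, _); apply: val_inj.
have j_bij : bijective j.
  by apply: inj_card_bij => //; rewrite card_prod !card_tuple expnSr.
by rewrite (reindex j) //=; apply: onW_bij.
Qed.

Lemma path_prob_rcons k T (w : T.-tuple X) x :
  path_prob k [tuple of rcons w x] = path_prob k w * k w x.
Proof.
rewrite /path_prob big_ord_recr /=; congr (_ * _).
  apply: eq_bigr => t _.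
  rewrite !(tnth_nth x) /= nth_rcons size_tuple ltn_ord -cats1 takel_cat//.
  by rewrite size_tuple ltnW.
rewrite (tnth_nth x) /= nth_rcons size_tuple ltnn eqxx -cats1 take_cat.
by rewrite size_tuple ltnn subnn take0 cats0.
Qed.

(** Tower property: conditioning on the first [T] entries leaves the mean over the last one.
    Histories grow at the end because the kernel reads the past in chronological order. *)
Lemma path_meanS k T f :
  path_mean k T.+1 f =
  path_mean k T (fun h => \sum_x k h x * f (rcons h x)).
Proof.
rewrite /path_mean sum_tuple_rcons; apply: eq_bigr => w _.
rewrite mulr_sumr; apply: eq_bigr => x _.
by rewrite path_prob_rcons mulrA.
Qed.

Lemma path_mean0 k f : path_mean k 0 f = f [::].
Proof.
rewrite /path_mean (bigD1 [tuple]) //= big1 => [|w]; last by rewrite tuple0.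
by rewrite /path_prob big_ord0 mul1r addr0.
Qed.

Lemma eq_path_mean k T f f' : f =1 f' -> path_mean k T f = path_mean k T f'.
Proof. by move=> ff'; apply: eq_bigr => w _; rewrite ff'. Qed.

Lemma path_meanD k T f f' :
  path_mean k T (fun h => f h + f' h) = path_mean k T f + path_mean k T f'.
Proof.
by rewrite -big_split; apply: eq_bigr => w _; rewrite mulrDr.
Qed.

Lemma path_meanZ k T c f :
  path_mean k T (fun h => c * f h) = c * path_mean k T f.
Proof.
by rewrite mulr_sumr; apply: eq_bigr => w _; rewrite mulrCA.
Qed.

Lemma path_mean_sum k T (I : finType) (f : I -> seq X -> R) :
  path_mean k T (fun h => \sum_i f i h) = \sum_i path_mean k T (f i).
Proof.
by rewrite exchange_big; apply: eq_bigr => w _; rewrite mulr_sumr.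
Qed.

Section Stochastic.
Variables (k : seq X -> X -> R) (k_stoch : stochastic k).

Lemma path_prob_ge0 T (w : T.-tuple X) : 0 <= path_prob k w.
Proof. by apply: prodr_ge0 => t _; apply: k_stoch.1. Qed.

Lemma path_mean_cst T c : path_mean k T (fun=> c) = c.
Proof.
elim: T => [|T IH]; first exact: path_mean0.
rewrite path_meanS -[RHS]IH; apply: eq_path_mean => h.
by rewrite -mulr_suml k_stoch.2 mul1r.
Qed.

(** The restriction to histories of nonzero probability matters: the revenue formula of the hard
    instances is available for feasible policies only. *)
Lemma le_path_mean T f f' :
  (forall w : T.-tuple X, path_prob k w != 0 -> f w <= f' w) ->
  path_mean k T f <= path_mean k T f'.
Proof.
move=> ff'; apply: ler_sum => w _.
have [->|w0] := eqVneq (path_prob k w) 0; first by rewrite !mul0r.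
by rewrite ler_wpM2l ?path_prob_ge0 ?ff'.
Qed.

Lemma path_mean_additiveS T g :
  path_mean k T.+1 (fun h => \sum_(x <- h) g x) =
  path_mean k T (fun h => \sum_(x <- h) g x) +
  path_mean k T (fun h => \sum_x k h x * g x).
Proof.
rewrite path_meanS -path_meanD; apply: eq_path_mean => h.
under eq_bigr do rewrite -cats1 big_cat big_seq1 mulrDr.
by rewrite big_split -mulr_suml k_stoch.2 mul1r.
Qed.

(** Plays the part of the chain rule: a bound on the conditional relative entropy of each period
    becomes a bound on that of the whole history. *)
Lemma le_path_mean_additive T g g' :
  (forall h, \sum_x k h x * g x <= \sum_x k h x * g' x) ->
  path_mean k T (fun h => \sum_(x <- h) g x) <=
  path_mean k T (fun h => \sum_(x <- h) g' x).
Proof.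
move=> gg'; elim: T => [|T IH]; first by rewrite !path_mean0 !big_nil.
by rewrite !path_mean_additiveS lerD// le_path_mean.
Qed.

End Stochastic.

(** * Change of measure through relative entropy *)

Lemma ln_le_sub1 (x : R) : 0 < x -> ln x <= x - 1.
Proof.
move=> x0; rewrite -[x in ln x](subrKC 1).
by apply: le_ln1Dx; rewrite ltrBrDr addNr.
Qed.

(** Pointwise Pinsker for a likelihood ratio [x]: under the reference law [1 + x] has mean 2 and
    [x - 1 - ln x] has the relative entropy as mean. *)
Lemma sub1_le_relative_entropy (eta x : R) : 0 < eta -> 0 < x ->
  x - 1 <= eta * (1 + x) + (2 * eta)^-1 * (x - 1 - ln x).
Proof.
move=> eta0 x0; set s := Num.sqrt x.
have s0 : 0 < s by rewrite sqrtr_gt0.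
have xE : x = s ^+ 2 by rewrite sqr_sqrtr// ltW.
have lnxE : ln x = 2 * ln s by rewrite xE lnXn// mulr_natl.
(* [(s - 1)^2 <= x - 1 - ln x] since [ln s <= s - 1]; then AM-GM on
   [x - 1 = (s - 1) * (s + 1)]. *)
have hell : (s - 1) ^+ 2 <= x - 1 - ln x.
  by rewrite lnxE xE; have := ln_le_sub1 s0; lra.
have i0 : 0 < (2 * eta)^-1 by rewrite invr_gt0 mulr_gt0.
apply: le_trans (_ : _ <= eta * (1 + x) + (2 * eta)^-1 * (s - 1) ^+ 2) _;
  last by rewrite lerD2l ler_pM2l.
rewrite -subr_ge0.
have -> : eta * (1 + x) + (2 * eta)^-1 * (s - 1) ^+ 2 - (x - 1) =
  (2 * eta)^-1 * ((s - 1) - eta * (s + 1)) ^+ 2 + eta / 2 * (s - 1) ^+ 2.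
  by rewrite xE; field; rewrite gt_eqF.
by rewrite addr_ge0// mulr_ge0 ?sqr_ge0 ?divr_ge0// ltW.
Qed.

(* Linearised Pinsker inequality: the free parameter [eta] replaces the square
   root of the relative entropy. *)
Lemma path_mean_change (k0 k1 : seq X -> X -> R) (r : X -> R) T f (b eta : R) :
  stochastic k0 -> stochastic k1 ->
  (forall h x, k1 h x = k0 h x * r x) -> (forall x, 0 < r x) ->
  0 < eta -> (forall w : T.-tuple X, 0 <= f w <= b) ->
  path_mean k1 T f <= path_mean k0 T f +
    b * (2 * eta + (2 * eta)^-1 *
         path_mean k0 T (fun h => \sum_(x <- h) - ln (r x))).
Proof.
move=> st0 st1 k1E r0 eta0 fb.
(* Likelihood ratio of a whole history; its mean under [k0] is 1. *)
pose z (h : seq X) := \prod_(x <- h) r x.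
have z0 h : 0 < z h by apply: prodr_gt0.
have lnz h : ln (z h) = \sum_(x <- h) ln (r x).
  rewrite /z; elim: h => [|x h IH]; first by rewrite !big_nil ln1.
  by rewrite !big_cons lnM ?IH ?posrE//; apply: z0.
have p1E (w : T.-tuple X) : path_prob k1 w = path_prob k0 w * z w.
  rewrite /path_prob /z big_tuple -big_split.
  by apply: eq_bigr => t _; rewrite k1E.
have mz : path_mean k0 T z = 1.
  rewrite -(path_mean_cst st1 T 1); apply: eq_bigr => w _.
  by rewrite p1E mulr1.
have -> : path_mean k1 T f = path_mean k0 T (fun h => z h * f h).
  by apply: eq_bigr => w _; rewrite p1E mulrA.
(* The mean of [g] under [k0] is the right-hand side, so it suffices that [g] dominates [z * f]
   pointwise. *)
pose g h := f h + b * (eta * (1 + z h) + (2 * eta)^-1 *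
  (z h - 1 + \sum_(x <- h) - ln (r x))).
have -> : path_mean k0 T f + b * (2 * eta + (2 * eta)^-1 *
    path_mean k0 T (fun h => \sum_(x <- h) - ln (r x))) = path_mean k0 T g.
  rewrite /g path_meanD path_meanZ path_meanD !path_meanZ !path_meanD.
  by rewrite !path_mean_cst// mz; congr (_ + b * (_ + _ * _)); ring.
apply: le_path_mean => // w _; rewrite /g sumrN -lnz.
have /andP[f0 f1] := fb w.
have := sub1_le_relative_entropy eta0 (z0 w).
set e := eta * _ + _ => ez.
have e0 : 0 <= e.
  have lnz_le : 0 <= z w - 1 - ln (z w) by rewrite subr_ge0 ln_le_sub1.
  apply: addr_ge0; apply: mulr_ge0 => //; first exact: ltW.
    by rewrite addr_ge0 // ltW.
  by rewrite invr_ge0 mulr_ge0 // ltW.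
rewrite -lerBlDl.
(* [(z - 1) * f <= f * e <= b * e]: the first inequality uses [0 <= f], the second [0 <= e]. *)
apply: le_trans (_ : f w * e <= _); last by rewrite ler_wpM2r.
by rewrite -[X in _ - X]mul1r -mulrBl mulrC ler_wpM2l.
Qed.

End Paths.

(** * Law of one period, and regret as a mean over histories *)

Lemma bernoulli_pmf_bool (R : realType) (p : R) (b : bool) :
  bernoulli_pmf p b = if b then p else 1 - p.
Proof. by []. Qed.

Lemma sum_bernoulli_pmf (R : realType) (p : R) (phi : bool -> R) :
  \sum_b bernoulli_pmf p b * phi b = p * phi true + (1 - p) * phi false.
Proof. by rewrite big_bool !bernoulli_pmf_bool. Qed.

Lemma sum_bernoulli_pmf1 (R : realType) (p : R) : \sum_b bernoulli_pmf p b = 1.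
Proof. by rewrite big_bool !bernoulli_pmf_bool /= subrKC. Qed.

Section Observations.
Variables (R : realType) (N M : nat) (mk : market R N M).
Implicit Types (d : demand mk) (A : learning_algorithm mk) (pi : policy mk).

Lemma sum_obs_prob_core d pi (n : 'I_N) (phi : bool -> R) :
  \sum_o obs_prob d pi o * phi (core_bought o n) =
  \sum_b bernoulli_pmf (alpha_core d n (core_price pi n)) b * phi b.
Proof.
pose pc (i : 'I_N) b := bernoulli_pmf (alpha_core d i (core_price pi i)) b.
pose ps (m : 'I_M) b := bernoulli_pmf (alpha_supp d m (supp_price pi m)) b.
pose pa (c : {ffun 'I_N -> bool}) (i : 'I_N * 'I_M) b :=
  bernoulli_pmf (if c i.1 then addon_prob d pi i.2 else 0) b.
have -> : \sum_o obs_prob d pi o * phi (core_bought o n) =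
  \sum_(c : {ffun 'I_N -> bool}) \sum_(s : {ffun 'I_M -> bool})
  \sum_(a : {ffun 'I_N * 'I_M -> bool})
    (\prod_i pc i (c i)) * phi (c n) * (\prod_m ps m (s m)) *
    \prod_i pa c i (a i).
  rewrite pair_bigA pair_bigA /=; apply: eq_bigr => -[[c s] a] _.
  rewrite /obs_prob /core_bought /supp_bought /addon_bought /=.
  rewrite pair_bigA /=.
  by under [X in _ * X * phi _]eq_bigr do rewrite -surjective_pairing; ring.
(* The add-on law depends on the core purchases [c], so add-ons are summed out first, with [c]
   fixed. *)
have sa c : \sum_(a : {ffun 'I_N * 'I_M -> bool}) \prod_i pa c i (a i) = 1.
  by rewrite -bigA_distr_bigA big1// => i _; rewrite sum_bernoulli_pmf1.
have ss : \sum_(s : {ffun 'I_M -> bool}) \prod_m ps m (s m) = 1.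
  by rewrite -bigA_distr_bigA big1// => i _; rewrite sum_bernoulli_pmf1.
(* [phi] is absorbed into the factor of product [n], so that the sum over [c] factorizes. *)
pose pcn (i : 'I_N) b := pc i b * (if i == n then phi b else 1).
transitivity (\sum_(c : {ffun 'I_N -> bool}) \prod_i pcn i (c i)).
  apply: eq_bigr => c _.
  transitivity ((\prod_i pc i (c i)) * phi (c n)).
    rewrite -[RHS]mulr1 -[X in _ = _ * X]ss mulr_sumr; apply: eq_bigr => s _.
    by rewrite -[RHS]mulr1 -[X in _ = _ * X](sa c) mulr_sumr.
  rewrite /pcn big_split /=; congr (_ * _).
  by rewrite -big_mkcond big_pred1_eq.
rewrite -bigA_distr_bigA (bigD1 n)//= [X in _ * X]big1 => [|i ni].
  by rewrite mulr1; apply: eq_bigr => b _; rewrite /pcn eqxx.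
rewrite -[RHS](sum_bernoulli_pmf1 (alpha_core d i (core_price pi i))).
by apply: eq_bigr => b _; rewrite /pcn (negbTE ni) mulr1.
Qed.

Lemma sum_obs_prob d pi : (0 < N)%N -> \sum_o obs_prob d pi o = 1.
Proof.
move=> N0; have := sum_obs_prob_core d pi (Ordinal N0) (fun=> 1).
under eq_bigr do rewrite mulr1; move=> ->.
by under eq_bigr do rewrite mulr1; exact: sum_bernoulli_pmf1.
Qed.

Lemma obs_prob_ge0 d pi o : 0 <= obs_prob d pi o.
Proof.
rewrite /obs_prob !mulr_ge0 ?prodr_ge0// => i _; last first.
  apply: prodr_ge0 => m _; apply: bernoulli_pmf_ge0.
  case: ifP => _; last by rewrite lexx ler01.
  by rewrite /addon_prob; case: ifP => _;
    [apply: beta_disc_prob | apply: beta_orig_prob].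
- by apply: bernoulli_pmf_ge0; apply: alpha_supp_prob.
- by apply: bernoulli_pmf_ge0; apply: alpha_core_prob.
Qed.

(** A sale of product [n] alone makes the primary demand nonzero. The condition [a <= 1] covers the
    default value 1 of the minimum. *)
Lemma min_primary_prob_ge d (a : R) (n : 'I_N) : a <= 1 ->
  (forall p, a <= alpha_core d n p) -> a <= min_primary_prob d.
Proof.
move=> a1 a_le; rewrite /min_primary_prob.
elim/big_ind : _ => // [x y ax ay|pi _]; first by rewrite le_min ax.
apply: le_trans (a_le (core_price pi n)) _.
have -> : alpha_core d n (core_price pi n) =
    \sum_o obs_prob d pi o * (core_bought o n)%:R.
  by rewrite (sum_obs_prob_core d pi n (fun b => b%:R)) sum_bernoulli_pmf mulr1
    mulr0 addr0.
rewrite [leRHS]big_mkcond /=; apply: ler_sum => o _.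
case: ifPn => [_|].
  by rewrite ler_piMr ?obs_prob_ge0//; case: core_bought.
rewrite negb_or => /andP[/existsPn/(_ n)/negbTE -> _].
by rewrite mulr0.
Qed.

Definition round_prob d A (h : seq (policy mk * observation N M))
    (x : policy mk * observation N M) : R :=
  choice_prob A h x.1 * obs_prob d x.1 x.2.

Lemma sum_round_prob d A h (phi : policy mk * observation N M -> R) :
  \sum_x round_prob d A h x * phi x =
  \sum_pi choice_prob A h pi * \sum_o obs_prob d pi o * phi (pi, o).
Proof.
under [RHS]eq_bigr do rewrite mulr_sumr.
by rewrite pair_bigA; apply: eq_bigr => -[pi o] _; rewrite /round_prob mulrA.
Qed.

Lemma round_prob_stochastic d A : (0 < N)%N -> stochastic (round_prob d A).
Proof.
move=> N0; split=> [h x|h].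
  by rewrite mulr_ge0 ?choice_prob_ge0 ?obs_prob_ge0.
transitivity (\sum_x round_prob d A h x * 1).
  by under [RHS]eq_bigr do rewrite mulr1.
rewrite (sum_round_prob d A h (fun=> 1)) -[RHS](choice_prob_sum1 A h).
apply: eq_bigr => pi _; under eq_bigr do rewrite mulr1.
by rewrite sum_obs_prob// mulr1.
Qed.

Lemma regretE d A T :
  regret d A T = path_mean (round_prob d A) T
    (fun h => \sum_(x <- h) (opt_revenue d - revenue d x.1)).
Proof. by apply: eq_bigr => w _; rewrite big_tuple. Qed.

Lemma run_feasible d A T (w : T.-tuple (policy mk * observation N M)) :
  path_prob (round_prob d A) w != 0 -> forall t, feasible (tnth w t).1.
Proof.
move=> w0 t; apply: contraNT w0 => /(choice_prob_feasible A (take t w)) c0.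
by rewrite /path_prob (bigD1 t)//= {1}/round_prob c0 !mul0r.
Qed.

Definition num_offers (n : 'I_N) (p : core_prices mk)
    (h : seq (policy mk * observation N M)) : R :=
  \sum_(x <- h) (core_price x.1 n == p)%:R.

Lemma sum_num_offers n h : \sum_p num_offers n p h = (size h)%:R.
Proof.
rewrite /num_offers exchange_big /= -sum1_size natr_sum.
apply: eq_bigr => x _; rewrite (bigD1 (core_price x.1 n))//= eqxx big1 ?addr0//.
by move=> p; rewrite eq_sym => /negbTE ->.
Qed.

End Observations.

(** * The hard demand functions and their regret *)

Section BanditInstance.
Variables (R : realType) (N M : nat) (phat : R) (mk : market R N M).
Hypotheses (N_gt0 : (0 < N)%N) (M_gt0 : (0 < M)%N) (phat_gt0 : 0 < phat).
Hypothesis core_le : forall p : core_prices mk, fsval p <= phat.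
Hypothesis supp_eq : forall p : supp_prices mk, fsval p = phat.
Hypothesis no_space : space_limit mk = 0%N.
Variables (gap : R) (gap_ge0 : 0 <= gap) (gap_le : gap <= 1 / 4).

Local Notation mass := (M%:R * phat).

Definition arm_weight (p : core_prices mk) : R := mass / (fsval p + mass).

Lemma mass_gt0 : 0 < mass.
Proof. by rewrite mulr_gt0// ltr0n. Qed.

Lemma core_ge0 (p : core_prices mk) : 0 <= fsval p.
Proof. exact/core_prices_ge0/fsvalP. Qed.

Lemma arm_weight_ge p : 1 / 2 <= arm_weight p.
Proof.
have := core_ge0 p; have := mass_gt0 => m0 p0.
rewrite /arm_weight ler_pdivlMr ?ltr_wpDl//.
have : phat <= mass by rewrite ler_peMl ?ler1n// ltW.
by have := core_le p; lra.
Qed.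

Lemma arm_weight_le p : arm_weight p <= 1.
Proof.
have := core_ge0 p; have := mass_gt0 => m0 p0.
by rewrite /arm_weight ler_pdivrMr ?ltr_wpDl// mul1r lerDr.
Qed.

(** Since [p <= phat <= M * phat], the weight lies between 1/2 and 1. Keeping purchase probabilities
    away from 0 and 1 bounds both the relative entropies and the inverse of lambda. *)
Lemma arm_bounds p (e : R) : 0 <= e <= 1 / 4 ->
  1 / 4 <= arm_weight p * (1 / 2 + e) <= 3 / 4.
Proof.
case/andP=> e0 e1; have := arm_weight_ge p; have := arm_weight_le p.
rewrite mulrDr; set w := arm_weight p => w1 w2.
have : 0 <= w * e by apply: mulr_ge0 => //; lra.
have : w * e <= e by apply: ler_piMl.
by move=> ? ?; apply/andP; split; lra.
Qed.

Lemma arm_bounds0 p : 1 / 4 <= arm_weight p * (1 / 2) <= 3 / 4.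
Proof.
by have := @arm_bounds p 0; rewrite addr0; apply; apply/andP; split; lra.
Qed.

Lemma arm_boundsg p : 1 / 4 <= arm_weight p * (1 / 2 + gap) <= 3 / 4.
Proof. by apply: arm_bounds; rewrite gap_ge0. Qed.

(* The weight makes the expected revenue [alpha * (p + M * phat)] earned by a
   core product the same at every price, except at the good one. *)
Definition bandit_alpha (g : 'I_N -> option (core_prices mk)) (n : 'I_N)
    (p : core_prices mk) : R :=
  arm_weight p * (1 / 2 + gap * (g n == Some p)%:R).

Lemma bandit_alpha_bounds g n p : 1 / 4 <= bandit_alpha g n p <= 3 / 4.
Proof.
rewrite /bandit_alpha; case: eqP => _; rewrite ?mulr1 ?mulr0 ?addr0.
  exact: arm_boundsg.
exact: arm_bounds0.
Qed.

Lemma bandit_alpha_prob g n p : 0 <= bandit_alpha g n p <= 1.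
Proof.
by have /andP[] := bandit_alpha_bounds g n p => ? ?; apply/andP; split; lra.
Qed.

Lemma prob0 : 0 <= (0 : R) <= 1. Proof. by rewrite lexx ler01. Qed.
Lemma prob1 : 0 <= (1 : R) <= 1. Proof. by rewrite lexx ler01. Qed.

Definition bandit_demand g : demand mk :=
  @Demand R N M mk (bandit_alpha g) (fun _ _ => 0) (fun _ _ => 1) (fun _ _ => 0)
    (bandit_alpha_prob g) (fun _ _ => prob0) (fun _ _ => prob1)
    (fun _ _ => prob0).

(** Feasibility without space forces an empty selection, so each core sale brings [M] add-on sales
    at [phat]; [arm_weight] then cancels the factor [p + M * phat]. *)
Lemma bandit_revenue g (pi : policy mk) : feasible pi ->
  revenue (bandit_demand g) pi =
  \sum_n mass * (1 / 2 + gap * (g n == Some (core_price pi n))%:R).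
Proof.
rewrite /feasible no_space leqn0 cards_eq0 => /andP[/eqP sel0 _].
rewrite /revenue sel0 /=.
under [X in _ + X + _]eq_bigr do rewrite mul0r.
rewrite [X in _ + X + _]big1_eq addr0.
have -> : \sum_(m < M) (if m \in finset.set0 then
    0 * fsval (disc_price pi m) else 1 * fsval (supp_price pi m)) = mass.
  under eq_bigr do rewrite inE mul1r supp_eq.
  by rewrite sumr_const card_ord mulr_natl.
rewrite mulr_suml -big_split; apply: eq_bigr => n _ /=.
rewrite -mulrDr /bandit_alpha /arm_weight.
have := core_ge0 (core_price pi n); have := mass_gt0 => m0 p0.
by rewrite mulrAC divfK// gt_eqF// ltr_wpDl.
Qed.

Hypothesis exists_feasible : exists pi : policy mk, feasible pi.

Lemma bandit_opt_revenue (g : 'I_N -> core_prices mk) :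
  N%:R * (mass * (1 / 2 + gap)) <= opt_revenue (bandit_demand (Some \o g)).
Proof.
have [pi pi_feas] := exists_feasible.
(* Feasibility ignores core prices, so they can all be replaced by the good arms. *)
pose pi' : policy mk := ([ffun n => g n], pi.1.1.2, pi.1.2, pi.2).
have feas' : feasible pi' by [].
rewrite /opt_revenue; apply: le_trans (le_bigmax_cond _ _ feas').
rewrite bandit_revenue//.
under eq_bigr do rewrite /core_price /= ffunE eqxx mulr1.
by rewrite sumr_const card_ord mulr_natl.
Qed.

(** Each period in which product [n] is not priced at [g n] costs at least [mass * gap],
    independently of the other products. *)
Lemma bandit_regret_ge (g : 'I_N -> core_prices mk)
    (A : learning_algorithm mk) T :
  mass * gap * \sum_n (T%:R - path_mean
    (round_prob (bandit_demand (Some \o g)) A) T (num_offers n (g n))) <=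
  regret (bandit_demand (Some \o g)) A T.
Proof.
set d := bandit_demand (Some \o g).
have st := round_prob_stochastic d A N_gt0.
have -> : mass * gap * \sum_n (T%:R -
    path_mean (round_prob d A) T (num_offers n (g n))) =
  path_mean (round_prob d A) T (fun h =>
    mass * gap * \sum_n (T%:R + -1 * num_offers n (g n) h)).
  rewrite path_meanZ path_mean_sum; congr (_ * _); apply: eq_bigr => n _.
  by rewrite path_meanD path_meanZ path_mean_cst// mulN1r.
rewrite regretE; apply: le_path_mean => // w /run_feasible w_feas.
have -> : \sum_n (T%:R + -1 * num_offers n (g n) w) =
    \sum_(x <- w) \sum_n (1 - (core_price x.1 n == g n)%:R).
  rewrite exchange_big /=; apply: eq_bigr => n _.
  by rewrite sumrB mulN1r big_tuple sumr_const card_ord.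
rewrite mulr_sumr !big_tuple; apply: ler_sum => t _.
rewrite bandit_revenue//.
apply: le_trans (lerB (bandit_opt_revenue g) (lexx _)).
have -> : N%:R * (mass * (1 / 2 + gap)) = \sum_(n < N) mass * (1 / 2 + gap).
  by rewrite sumr_const card_ord mulr_natl.
rewrite -sumrB mulr_sumr.
apply: ler_sum => n _; rewrite le_eqVlt; apply/orP; left; apply/eqP.
rewrite /= (inj_eq Some_inj) eq_sym; ring.
Qed.

(** * Information gained about one arm in one period *)

Definition lik_ratio (n : 'I_N) (p : core_prices mk)
    (x : policy mk * observation N M) : R :=
  if core_price x.1 n == p then
    bernoulli_pmf (arm_weight p * (1 / 2 + gap)) (core_bought x.2 n) /
    bernoulli_pmf (arm_weight p * (1 / 2)) (core_bought x.2 n)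
  else 1.

Lemma bernoulli_pmf_gt0 (q : R) b :
  1 / 4 <= q <= 3 / 4 -> 0 < bernoulli_pmf q b.
Proof. by case/andP=> q0 q1; rewrite bernoulli_pmf_bool; case: b; lra. Qed.

Lemma lik_ratio_gt0 n p x : 0 < lik_ratio n p x.
Proof.
rewrite /lik_ratio; case: ifP => // _; rewrite divr_gt0// bernoulli_pmf_gt0//.
  exact: arm_boundsg.
exact: arm_bounds0.
Qed.

Lemma obs_prob_change (g0 g1 : 'I_N -> option (core_prices mk)) n p pi o :
  g0 n = None -> g1 n = Some p -> (forall i, i != n -> g0 i = g1 i) ->
  obs_prob (bandit_demand g1) pi o =
  obs_prob (bandit_demand g0) pi o * lik_ratio n p (pi, o).
Proof.
move=> g0n g1n g01; rewrite /obs_prob /=.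
rewrite [in LHS](bigD1 n)//= [in RHS](bigD1 n)//=.
have -> : \prod_(i < N | i != n) bernoulli_pmf
      (bandit_alpha g1 i (core_price pi i)) (core_bought o i) =
    \prod_(i < N | i != n) bernoulli_pmf
      (bandit_alpha g0 i (core_price pi i)) (core_bought o i).
  by apply: eq_bigr => i ni; rewrite /bandit_alpha g01.
have -> : addon_prob (bandit_demand g1) pi = addon_prob (bandit_demand g0) pi.
  by [].
have -> :
    bernoulli_pmf (bandit_alpha g1 n (core_price pi n)) (core_bought o n) =
    bernoulli_pmf (bandit_alpha g0 n (core_price pi n)) (core_bought o n) *
    lik_ratio n p (pi, o).
  rewrite /lik_ratio /= /bandit_alpha g0n g1n (inj_eq Some_inj) eq_sym /=.
  rewrite mulr0 addr0; case: eqP => [->|_]; last by rewrite mulr0 addr0 mulr1.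
  by rewrite mulr1 [RHS]mulrC divfK// gt_eqF// bernoulli_pmf_gt0// arm_bounds0.
by ring.
Qed.

Lemma relative_entropy_obs (g0 : 'I_N -> option (core_prices mk)) n p pi :
  g0 n = None ->
  \sum_o obs_prob (bandit_demand g0) pi o * - ln (lik_ratio n p (pi, o)) <=
  6 * gap ^+ 2 * (core_price pi n == p)%:R.
Proof.
move=> g0n; rewrite /lik_ratio /=; case: eqP => [pE|_]; last first.
  by rewrite mulr0 big1// => o _; rewrite ln1 oppr0 mulr0.
rewrite (sum_obs_prob_core _ _ _ (fun b => - ln (
  bernoulli_pmf (arm_weight p * (1 / 2 + gap)) b /
  bernoulli_pmf (arm_weight p * (1 / 2)) b))).
have /andP[] := arm_boundsg p; have /andP[] := arm_bounds0 p.
rewrite sum_bernoulli_pmf !bernoulli_pmf_bool /= /bandit_alpha g0n /= pE.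
rewrite mulr0 addr0 mulr1.
have := arm_weight_le p; have := arm_weight_ge p.
set w := arm_weight p; set a := w * (1 / 2); set b := w * (1 / 2 + gap).
move=> w2 w1 a0 a1 b0 b1.
have bE : b = a + w * gap by rewrite /b /a; ring.
(* [- ln x <= 1 / x - 1] bounds the relative entropy by the chi-square
   divergence [(a - b)^2 / (b * (1 - b))]. *)
have nln (u v : R) : 0 < u -> 0 < v -> - ln (u / v) <= v / u - 1.
  move=> u0 v0; rewrite -lnV ?posrE ?divr_gt0// invf_div.
  by apply: ln_le_sub1; rewrite divr_gt0.
apply: (@le_trans _ _ (a * (a / b - 1) + (1 - a) * ((1 - a) / (1 - b) - 1))).
  by apply: lerD; apply: ler_wpM2l; rewrite ?nln//; lra.
have -> : a * (a / b - 1) + (1 - a) * ((1 - a) / (1 - b) - 1) =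
    (w * gap) ^+ 2 / (b * (1 - b)).
  rewrite (_ : w * gap = b - a); last by rewrite bE; ring.
  by field; rewrite !gt_eqF//; lra.
(* 3/16 is the value of [b * (1 - b)] at 1/4 and 3/4. With [w <= 1] the divergence is at most
   [16 / 3 * gap ^ 2], rounded up to [6 * gap ^ 2]. *)
have bb : 3 / 16 <= b * (1 - b) by nra.
rewrite ler_pdivrMr; last by apply: lt_le_trans bb; lra.
have w21 : w ^+ 2 <= 1 by rewrite expr_le1//; lra.
rewrite exprMn; have := sqr_ge0 gap; set s := gap ^+ 2 => s0; nra.
Qed.

(** * Averaging over the positions of the good arms *)

Definition set_arm (g : {ffun 'I_N -> core_prices mk}) n p :
  {ffun 'I_N -> core_prices mk} := [ffun i => if i == n then p else g i].

(** Common reference instance for all [set_arm g n p]: it does not depend on [p]. *)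
Definition no_good_arm (g : {ffun 'I_N -> core_prices mk}) n (i : 'I_N) :=
  if i == n then None else Some (g i).

Lemma num_offers_bounds n p T (w : T.-tuple (policy mk * observation N M)) :
  0 <= num_offers n p w <= T%:R.
Proof.
rewrite /num_offers big_tuple sumr_ge0//=.
rewrite (_ : T%:R = \sum_(t < T) 1); last by rewrite sumr_const card_ord.
by apply: ler_sum => t _; case: eqP.
Qed.

(** Each term is compared with its value under the reference instance, where the offers of all arms
    of product [n] add up to [T]. *)
Lemma num_offers_good_arm_le (A : learning_algorithm mk) T g n (eta : R) :
  0 < eta ->
  \sum_p path_mean (round_prob (bandit_demand (Some \o set_arm g n p)) A) T
      (num_offers n p) <=
  T%:R * (1 + 3 * gap ^+ 2 / eta * T%:R + 2 * eta * #|{: core_prices mk}|%:R).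
Proof.
move=> eta0; pose d0 := bandit_demand (no_good_arm g n).
have st d := round_prob_stochastic d A N_gt0.
pose m0 p := path_mean (round_prob d0 A) T (num_offers n p).
have sum_m0 : \sum_p m0 p = T%:R.
  rewrite -path_mean_sum -(path_mean_cst (st d0) T T%:R).
  by apply: eq_bigr => w _; rewrite sum_num_offers size_tuple.
have g0n : no_good_arm g n n = None by rewrite /no_good_arm eqxx.
have le_m0 p :
    path_mean (round_prob (bandit_demand (Some \o set_arm g n p)) A) T
      (num_offers n p) <=
    m0 p + T%:R * (2 * eta + (2 * eta)^-1 * (6 * gap ^+ 2 * m0 p)).
  (* The choice probabilities are the same on both sides: given the history, the algorithm does not
     see the demand. *)
  have kE h x : round_prob (bandit_demand (Some \o set_arm g n p)) A h x =
      round_prob d0 A h x * lik_ratio n p x.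
    case: x => pi o; rewrite /round_prob /= -mulrA; congr (_ * _).
    apply: obs_prob_change => [//||i /negbTE ni].
      by rewrite /= ffunE eqxx.
    by rewrite /no_good_arm /= ffunE ni.
  have := path_mean_change (st d0) (st _) kE (lik_ratio_gt0 n p) eta0
    (@num_offers_bounds n p T).
  move/le_trans; apply.
  rewrite lerD2l ler_wpM2l// lerD2l.
  rewrite ler_wpM2l ?invr_ge0 ?(ltW (mulr_gt0 _ eta0))//.
  rewrite -path_meanZ.
  apply: le_trans (_ : _ <= path_mean (round_prob d0 A) T
    (fun h => \sum_(x <- h) 6 * gap ^+ 2 * (core_price x.1 n == p)%:R)) _.
    apply: le_path_mean_additive => // h; rewrite !sum_round_prob.
    apply: ler_sum => pi _; rewrite ler_wpM2l ?choice_prob_ge0//=.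
    by rewrite -mulr_suml sum_obs_prob// mul1r relative_entropy_obs.
  by apply: le_path_mean => // w _; rewrite mulr_sumr.
apply: le_trans (ler_sum _ (fun p _ => le_m0 p)) _.
rewrite big_split /= sum_m0 -mulr_sumr big_split /= sumr_const.
rewrite -!mulr_sumr sum_m0.
rewrite le_eqVlt; apply/orP; left; apply/eqP.
by rewrite -mulr_natr; field; rewrite gt_eqF.
Qed.

(* [(g, p) |-> (set_arm g n p, g n)] is an involution. *)
Lemma sum_set_arm (F : {ffun 'I_N -> core_prices mk} -> R) n :
  \sum_g \sum_p F (set_arm g n p) = #|{: core_prices mk}|%:R * \sum_g F g.
Proof.
pose swap (u : {ffun 'I_N -> core_prices mk} * core_prices mk) :=
  (set_arm u.1 n u.2, u.1 n).
have swapK : involutive swap.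
  move=> [g p]; rewrite /swap /= ffunE eqxx; congr (_, _).
  by apply/ffunP => i; rewrite !ffunE; case: eqP => [->|].
rewrite pair_bigA /=.
transitivity (\sum_(u : {ffun 'I_N -> core_prices mk} * core_prices mk) F u.1).
  by rewrite [RHS](reindex_inj (inv_inj swapK)).
rewrite -(pair_bigA _ (fun g (p : core_prices mk) => F g)) /= mulr_sumr.
by apply: eq_bigr => g _; rewrite sumr_const mulr_natl.
Qed.

(** Probabilistic method: with [g] uniform, the average over [g] bounds the offers of every product
    at once, and some [g] is at least as bad for [A] as the average. *)
Lemma exists_hard_bandit (A : learning_algorithm mk) T (eta : R) :
  (0 < #|{: core_prices mk}|)%N -> 0 < eta ->
  let U := #|{: core_prices mk}|%:R in
  exists g : {ffun 'I_N -> core_prices mk},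
  mass * gap * (N%:R * (T%:R *
      (1 - (1 + 3 * gap ^+ 2 / eta * T%:R) / U - 2 * eta)))
    <= regret (bandit_demand (Some \o g)) A T.
Proof.
move=> U_gt0 eta0 U.
have U0 : 0 < U by rewrite ltr0n.
pose F n (g : {ffun 'I_N -> core_prices mk}) := path_mean
  (round_prob (bandit_demand (Some \o g)) A) T (num_offers n (g n)).
set b := T%:R * _.
(* Resampling the arm of product [n] by [sum_set_arm] costs a factor [U], which produces the
   division by [U] in the bound. *)
have sumF n :
    \sum_g F n g <= \sum_(g : {ffun 'I_N -> core_prices mk}) (T%:R - b).
  rewrite -(ler_pM2l U0) -(sum_set_arm (F n) n) mulr_sumr.
  apply: ler_sum => g _; have := num_offers_good_arm_le A T g n eta0.
  rewrite -/U; under eq_bigr => p _.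
    rewrite (_ : path_mean _ _ _ = F n (set_arm g n p)); last first.
      by rewrite /F ffunE eqxx.
    over.
  move/le_trans; apply; rewrite le_eqVlt; apply/orP; left; apply/eqP.
  by rewrite /b; field; rewrite !gt_eqF.
have [g g_le] : exists g, N%:R * b <= \sum_n (T%:R - F n g).
  apply: contrapT => /forallNP no_g.
  have : \sum_(g : {ffun 'I_N -> core_prices mk}) \sum_n (T%:R - F n g) <
      \sum_(g : {ffun 'I_N -> core_prices mk}) N%:R * b.
    apply: ltr_sum => [|g _]; last by rewrite ltNge; apply/negP/no_g.
    have /card_gt0P[p _] := U_gt0.
    by apply/hasP; exists [ffun=> p]; rewrite ?mem_index_enum.
  apply/negP; rewrite -leNgt exchange_big /=.
  have -> : \sum_(g : {ffun 'I_N -> core_prices mk}) N%:R * b =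
      \sum_(n < N) \sum_(g : {ffun 'I_N -> core_prices mk}) b.
    by rewrite exchange_big; apply: eq_bigr => g _;
      rewrite [RHS]sumr_const card_ord mulr_natl.
  apply: ler_sum => n _; have := sumF n; rewrite !sumrB; lra.
exists g; apply: le_trans (bandit_regret_ge g A T).
by rewrite ler_wpM2l// mulr_ge0// ltW// mass_gt0.
Qed.

End BanditInstance.

(** * A market with [U] core prices in which [phat] is the largest price *)

Section HardMarket.
Variables (R : realType) (N M U : nat) (phat : R).
Hypotheses (U_gt0 : (0 < U)%N) (phat_gt0 : 0 < phat).

Definition grid_price (i : 'I_U) : R := phat * i%:R / U%:R.

Lemma grid_price_inj : injective grid_price.
Proof.
have U0 : U%:R != 0 :> R by rewrite pnatr_eq0 -lt0n.
move=> i j /(mulIf (invr_neq0 U0)) /(mulfI (lt0r_neq0 phat_gt0)) /eqP.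
by rewrite eqr_nat => /eqP /val_inj.
Qed.

Definition grid_prices : {fset R} := [fset grid_price i | i in 'I_U].

Lemma grid_prices_bounds p : p \in grid_prices -> 0 <= p <= phat.
Proof.
have U0 : 0 < U%:R :> R by rewrite ltr0n.
move=> /imfsetP[i _ ->].
rewrite /grid_price divr_ge0 ?mulr_ge0 ?(ltW phat_gt0)//=.
by rewrite ler_pdivrMr// ler_pM2l// ler_nat ltnW.
Qed.

Lemma card_grid_prices : #|` grid_prices| = U.
Proof.
rewrite /grid_prices card_imfset; last exact: grid_price_inj.
by rewrite -cardE card_ord.
Qed.

Lemma grid_prices_ge0 p : p \in grid_prices -> 0 <= p.
Proof. by move=> /grid_prices_bounds /andP[]. Qed.

Lemma phat_prices_ge0 p : p \in [fset phat] -> 0 <= p.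
Proof. by move=> /fset1P ->; exact: ltW. Qed.

Lemma zero_prices_ge0 p : p \in [fset (0 : R)] -> 0 <= p.
Proof. by move=> /fset1P ->. Qed.

Definition grid_market : market R N M :=
  Market N M 0 grid_prices_ge0 phat_prices_ge0 zero_prices_ge0.

Lemma max_price_grid_market : max_price grid_market = phat.
Proof.
rewrite /max_price /=; apply/eqP; rewrite eq_le; apply/andP; split.
  rewrite big_seq; apply: bigmax_le => [|p]; first exact: ltW.
  by rewrite in_fsetU => /orP[/grid_prices_bounds/andP[]//|/fset1P ->].
by apply: le_bigmax_seq => //; rewrite in_fsetU fset11 orbT.
Qed.

Lemma max_num_prices_grid_market : max_num_prices grid_market = U.
Proof.
by rewrite /max_num_prices /= !cardfs1 card_grid_prices maxnn; apply/maxn_idPl.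
Qed.

(** The only discount price, 0, lies strictly below the only supportive price [phat]. *)
Lemma grid_market_feasible : exists pi : policy grid_market, feasible pi.
Proof.
have /fset0Pn[p p_in] : grid_prices != fset0.
  by rewrite -cardfs_gt0 card_grid_prices.
pose c : core_prices grid_market := [` p_in].
pose s : supp_prices grid_market := [` fset11 phat].
pose a : disc_prices grid_market := [` fset11 (0 : R)].
exists ([ffun=> c], [ffun=> s], [ffun=> a], finset.set0).
rewrite /feasible /selected /= cards0 leqnn /=; apply/forallP => m.
by rewrite /disc_price /supp_price /= !ffunE.
Qed.

End HardMarket.

(** * Choice of constants and comparison with the upper bound *)

Lemma ln2_ge_half (R : realType) : 1 / 2 <= ln (2 : R).
Proof.
have := @ln_le_sub1 R 2^-1; rewrite lnV ?posrE// => /(_ _); lra.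
Qed.

Theorem mainTheorem3 (R : realType) :
  exists c C : R, 0 < c /\ 0 < C /\
  forall (N M U : nat) (phat : R),
    (0 < N)%N -> (0 < M)%N -> (1 < U)%N -> 0 < phat ->
  exists mk : market R N M,
    [/\ space_limit mk = 0%N, supp_prices mk = [fset phat],
        max_price mk = phat, max_num_prices mk = U
      & exists pi : policy mk, feasible pi] /\
  forall T : nat, (U <= T)%N ->
  forall A : learning_algorithm mk,
  exists d : demand mk,
    [/\ forall m p, alpha_supp d m p = 0,
        forall m p, beta_orig d m p = 1,
        0 < min_primary_prob d,
        c * (N%:R * M%:R * phat * Num.sqrt (U%:R * T%:R)) <= regret d A T
      & forall eps : R, 0 < eps ->
        ucb_rate d eps T <= C * (1 + eps) * Num.sqrt (ln T%:R) * regret d A T].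
Proof.
(* The second constant is 4 divided by the first, 4 being the bound on the inverse of lambda. *)
exists (3 / 320), (1280 / 3); split; first by lra.
split; first by lra.
move=> N M U phat N_gt0 M_gt0 U_gt1 phat_gt0.
have U_gt0 : (0 < U)%N by apply: ltnW.
pose mk := grid_market N M U_gt0 phat_gt0.
have mk_max : max_price mk = phat by apply: max_price_grid_market.
have mk_num : max_num_prices mk = U by apply: max_num_prices_grid_market.
have mk_feas : exists pi : policy mk, feasible pi.
  exact: grid_market_feasible.
exists mk; split=> // T UT A.
have core_le (p : core_prices mk) : fsval p <= phat.
  by have /andP[] := grid_prices_bounds U_gt0 phat_gt0 (fsvalP p).
have supp_eq (p : supp_prices mk) : fsval p = phat by apply/fset1P/fsvalP.
have cardU : #|{: core_prices mk}| = U by rewrite -cardfE card_grid_prices.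
have U2 : 2 <= U%:R :> R by rewrite ler_nat.
have UTr : U%:R <= T%:R :> R by rewrite ler_nat.
set u : R := U%:R in U2 UTr *; set t : R := T%:R in UTr *.
set s := Num.sqrt (u * t).
have t0 : 0 < t by lra.
have s0 : 0 <= s by apply: sqrtr_ge0.
have sE : s ^+ 2 = u * t by rewrite sqr_sqrtr// mulr_ge0//; lra.
(* This is where [U <= T] enters; it makes [gap] at most 1/40. *)
have st : s <= t.
  by rewrite -ler_sqr ?nnegrE ?(ltW t0)// sE expr2 ler_wpM2r// ltW.
(* This is [sqrt (U / T) / 40]. *)
pose gap := s / (40 * t).
have gap0 : 0 <= gap by rewrite divr_ge0// mulr_ge0// ltW.
have gap1 : gap <= 1 / 4 by rewrite ler_pdivrMr ?mulr_gt0//; lra.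
have card_gt0 : (0 < #|{: core_prices mk}|)%N by rewrite cardU.
have eta0 : 0 < 1 / 32 :> R by lra.
have [g] := exists_hard_bandit N_gt0 M_gt0 phat_gt0 core_le supp_eq
  (erefl : space_limit mk = 0%N) gap0 gap1 mk_feas A T card_gt0 eta0.
rewrite cardU -/u -/t; set d := bandit_demand _ _ _ _ _ _.
set r := regret d A T.
set v := N%:R * M%:R * phat => r_ge.
have v0 : 0 <= v by rewrite !mulr_ge0// ltW.
have vs0 : 0 <= v * s by apply: mulr_ge0.
have {}r_ge : 3 / 320 * (v * s) <= r.
  apply: le_trans r_ge.
  (* With [eta = 1 / 32] the terms free of [u^-1] are [1 - 1/16 - 96/1600 = 351/400]. Then [u >= 2]
     leaves [151/400], and [151/16000 >= 3/320]. *)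
  have -> : M%:R * phat * gap * (N%:R * (t * (1 -
      (1 + 3 * gap ^+ 2 / (1 / 32) * t) / u - 2 * (1 / 32)))) =
      v * s * ((351 / 400 - u^-1) / 40).
    rewrite (_ : gap ^+ 2 = u / (1600 * t)).
      by rewrite /gap /v; field; rewrite !gt_eqF//; lra.
    by rewrite /gap expr_div_n sE; field; rewrite gt_eqF.
  rewrite mulrC ler_wpM2l//.
  have : u^-1 <= 1 / 2 by rewrite div1r lef_pV2 ?posrE//; lra.
  by lra.
have min_ge : 1 / 4 <= min_primary_prob d.
  apply: (min_primary_prob_ge (n := Ordinal N_gt0)) => [|p]; first by lra.
  by have /andP[] := bandit_alpha_bounds M_gt0 phat_gt0 core_le gap0 gap1
    (Some \o g) (Ordinal N_gt0) p.
exists d; split;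
  [by [] | by [] | by apply: lt_le_trans min_ge; lra | exact: r_ge | ].
move=> eps eps0.
rewrite /ucb_rate mk_max mk_num -/v -/u -/t.
set l := Num.sqrt (ln t).
have lnt : 1 / 2 <= ln t.
  by apply: le_trans (ln2_ge_half R) _; rewrite ler_ln ?posrE//; lra.
have l0 : 0 <= l by apply: sqrtr_ge0.
have -> : Num.sqrt (u * t * ln t) = s * l by rewrite sqrtrM// mulr_ge0//; lra.
(* [u >= 2] and [ln t >= 1/2] give [u * ln t >= 1], so the [eps] term of the upper bound is absorbed
   by the main one. *)
have sqrt_t : Num.sqrt t <= s * l.
  rewrite -sqrtrM; last by rewrite mulr_ge0//; lra.
  by rewrite ler_wsqrtr//; nra.
have lambda_le : (min_primary_prob d)^-1 <= 4.
  by rewrite -[4]invrK lef_pV2 ?posrE ?invr_gt0//; lra.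
apply: le_trans (_ : v * ((4 + eps) * (s * l)) <= _).
  rewrite ler_wpM2l// mulrDl lerD//; first by rewrite ler_wpM2r// mulr_ge0.
  by rewrite ler_wpM2l// ltW.
apply: le_trans (_ : 1280 / 3 * (1 + eps) * l * (3 / 320 * (v * s)) <= _);
  last first.
  by apply: ler_wpM2l r_ge; apply: mulr_ge0 l0; apply: mulr_ge0; lra.
have : 0 <= v * s * l by apply: mulr_ge0.
set x := v * s * l => x0.
have -> : v * ((4 + eps) * (s * l)) = (4 + eps) * x by rewrite /x; ring.
have -> : 1280 / 3 * (1 + eps) * l * (3 / 320 * (v * s)) = (4 + 4 * eps) * x.
  by rewrite /x; field.
by rewrite ler_wpM2r//; lra.
Qed.
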